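(* Let $A\in\mathbb{R}^{m\times n}$ and let $G\in\mathbb{R}^{b\times m}$ be a sketching matrix. Suppose we run $k$ iterations of IterativeCUR on $A$ with block size $b$, where Osinsky's index selection algorithm is used on the row sketch of the residual matrix $S^{(i)}$ to obtain the row and column indices, and let $I_j$ and $J_j$ be the row and column indices obtained in the $j$th iteration. Then we obtain a rank-$(bk)$ CUR approximation to $A$, and the CUR decomposition satisfies $$\left\|A-A_{\bigcup_{j=1}^kI_j,\;\bigcup_{j=1}^kJ_j}\right\|_F\le(1+b)^k\,\|A\|_F\prod_{i=1}^k\frac{\left\|S^{(i)}-S^{(i)}X_i^\dagger X_i\right\|_F}{\left\|S^{(i)}\right\|_F},$$ where $$S^{(i)}=A-A_{\bigcup_{j=1}^{i-1}I_j,\;\bigcup_{j=1}^{i-1}J_j}\quad(S^{(1)}=A),\qquad X_i=G S^{(i)}=G\left(A-A_{\bigcup_{j=1}^{i-1}I_j,\;\bigcup_{j=1}^{i-1}J_j}\right).$$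
   Context: For a matrix $M\in\mathbb{R}^{m\times n}$ and index sets $I$ (rows), $J$ (columns), $M(I,J)$, $M(:,J)$, $M(I,:)$ are the corresponding submatrices, $\dagger$ is the Moore–Penrose pseudoinverse, $\|\cdot\|_F$ the Frobenius norm, and $M_{I,J}=M(:,J)\,M(I,J)^\dagger\,M(I,:)$ is the CUR (cross) approximation of $M$ with indices $I,J$. IterativeCUR with block size $b$: starting from empty index sets $I,J$, in iteration $i$ one has the sketch $X_i=GS^{(i)}$ of the current residual $S^{(i)}=A-A_{I,J}$, with a single sketching matrix $G$ reused in all iterations; one selects $b$ new column indices $J_i$ and $b$ new row indices $I_i$ by an index selection procedure and appends them: $I\leftarrow I\cup I_i$, $J\leftarrow J\cup J_i$. Osinsky's index selection algorithm: given a matrix $M\in\mathbb{R}^{m\times n}$ and a rank-$b$ approximation $Z\in\mathbb{R}^{m\times n}$ of $M$, it finds $b$ row indices $I$ and $b$ column indices $J$ such that $$\|M-M(:,J)M(I,J)^\dagger M(I,:)\|_F\le(b+1)\,\|M-Z\|_F .$$ In iteration $i$ it is used with $M=S^{(i)}$ and $Z=S^{(i)}X_i^\dagger X_i$, the approximation given by the row sketch $X_i$.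
   Formalization: The index selection is also required to return, in each iteration, a nonsingular b×b core S^(i)(I_i,J_i); with only the stated (b+1) error bound a zero pivot is allowed and the claim fails. ''Rank-(bk)'' is read as rank exactly bk. *)

(* Defs.v *)
From mathcomp Require Import all_boot all_order all_algebra.
From mathcomp Require Import reals.

Set Implicit Arguments.
Unset Strict Implicit.
Unset Printing Implicit Defensive.

Import Order.TTheory GRing.Theory Num.Theory.
Local Open Scope ring_scope.

Section Defs.
Variable R : realType.

Definition frob m n (M : 'M[R]_(m, n)) : R :=
  Num.sqrt (\sum_(i < m) \sum_(j < n) M i j ^+ 2).

(* The four Penrose equations.  The library's [pinvmx] is only some generalized
   inverse, not the Moore-Penrose one. *)
Definition penrose m n (M : 'M[R]_(m, n)) (B : 'M[R]_(n, m)) : bool :=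
  [&& M *m B *m M == M, B *m M *m B == B,
      (M *m B)^T == M *m B & (B *m M)^T == B *m M].

Lemma row_free_gram m n (F : 'M[R]_(m, n)) :
  row_free F -> F *m F^T \in unitmx.
Proof.
move=> Ffree; rewrite -row_free_unit -kermx_eq0; apply/eqP/row_matrixP => i.
rewrite row0; set v := row i _.
have vF0 : v *m F *m F^T = 0.
  by rewrite -mulmxA; apply/sub_kermxP; apply: row_sub.
suff : v *m F = 0.
  by move/eqP; rewrite mulmx_free_eq0 // => /eqP.
have: (v *m F) *m (v *m F)^T = 0 by rewrite trmx_mul mulmxA vF0 mul0mx.
move: (v *m F) => w /matrixP/(_ 0 0); rewrite !mxE => w0.
apply/rowP => j; rewrite mxE; apply/eqP; rewrite -sqrf_eq0; apply/eqP.
have := @psumr_eq0P _ _ xpredT (fun l => w 0 l ^+ 2).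
apply=> // [l _|]; first exact: sqr_ge0.
by rewrite -[RHS]w0; apply: eq_bigr => l _; rewrite mxE expr2.
Qed.

Lemma penrose_exists m n (M : 'M[R]_(m, n)) : exists B, penrose M B.
Proof.
have [r [C [F [MCF uF uC]]]] : exists r (C : 'M_(m, r)) (F : 'M_(r, n)),
    [/\ M = C *m F, F *m F^T \in unitmx & C^T *m C \in unitmx].
  exists (\rank M), (col_base M), (row_base M); split.
  - by rewrite mulmx_base.
  - exact: row_free_gram (row_base_free M).
  - rewrite -{2}[col_base M]trmxK; apply: row_free_gram.
    by rewrite /row_free mxrank_tr; exact: col_base_full.
pose iF := invmx (F *m F^T); pose iC := invmx (C^T *m C).
have iFT : iF^T = iF by rewrite trmx_inv trmx_mul trmxK.
have iCT : iC^T = iC by rewrite trmx_inv trmx_mul trmxK.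
have FF X : F *m (F^T *m (iF *m X)) = X :> 'M_(_, m).
  by rewrite !mulmxA mulmxV // mul1mx.
have CC p (X : 'M_(_, p)) : iC *m (C^T *m (C *m X)) = X.
  by rewrite (mulmxA C^T) mulKmx.
pose B := F^T *m (iF *m (iC *m C^T)).
have MB : M *m B = C *m (iC *m C^T) by rewrite MCF /B -mulmxA FF.
have BM : B *m M = F^T *m (iF *m F) by rewrite MCF /B -!mulmxA CC.
exists B; apply/and4P; split; apply/eqP.
- by rewrite MB MCF -!mulmxA CC.
- by rewrite BM /B -!mulmxA FF.
- by rewrite MB !trmx_mul trmxK iCT mulmxA.
- by rewrite BM !trmx_mul trmxK iFT mulmxA.
Qed.

Lemma penrose_unique m n (M : 'M[R]_(m, n)) B B' :
  penrose M B -> penrose M B' -> B = B'.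
Proof.
case/and4P=> /eqP a1 /eqP a2 /eqP a3 /eqP a4.
case/and4P=> /eqP b1 /eqP b2 /eqP b3 /eqP b4.
have e1 : M *m B = M *m B'.
  by rewrite -a3 -{1}b1 -[_ *m M *m B]mulmxA trmx_mul a3 b3 mulmxA a1.
have e2 : B *m M = B' *m M.
  by rewrite -a4 -{1}b1 -mulmxA mulmxA trmx_mul a4 b4 -mulmxA (mulmxA M) a1.
by rewrite -a2 e2 -mulmxA e1 mulmxA b2.
Qed.

Definition mp_inv m n (M : 'M[R]_(m, n)) : 'M[R]_(n, m) :=
  xchoose (penrose_exists M).

Lemma mp_invP m n (M : 'M[R]_(m, n)) : penrose M (mp_inv M).
Proof. exact: xchooseP. Qed.

(* M(I,J), M(:,J) and M(I,:), the indices being listed in increasing order. *)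
Definition sub_rc m n (M : 'M[R]_(m, n)) (I : {set 'I_m}) (J : {set 'I_n}) :
    'M[R]_(#|I|, #|J|) :=
  mxsub (fun i : 'I_#|I| => enum_val i) (fun j : 'I_#|J| => enum_val j) M.

Definition sub_c m n (M : 'M[R]_(m, n)) (J : {set 'I_n}) : 'M[R]_(m, #|J|) :=
  colsub (fun j : 'I_#|J| => enum_val j) M.

Definition sub_r m n (M : 'M[R]_(m, n)) (I : {set 'I_m}) : 'M[R]_(#|I|, n) :=
  rowsub (fun i : 'I_#|I| => enum_val i) M.

Definition CUR m n (M : 'M[R]_(m, n)) (I : {set 'I_m}) (J : {set 'I_n}) :
    'M[R]_(m, n) :=
  sub_c M J *m mp_inv (sub_rc M I J) *m sub_r M I.

(* (I, J) is an admissible output of Osinsky's algorithm on M and its rank-b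
   approximation Z.  The third clause makes the b x b core M(I,J) nonsingular,
   i.e. the cross approximation genuinely of rank b.  It holds automatically
   for the indices the algorithm returns when Z = M X^+ X with X = G M of rank
   b: the columns are chosen so that X(:,J) = G M(:,J) is nonsingular, hence
   M(:,J) has rank b, and the rows so that M(I,J) keeps that rank.  The error
   bound alone would allow a zero pivot, after which neither the rank claim nor
   the error bound for several iterations is true. *)
Definition osinsky_selection b m n (M Z : 'M[R]_(m, n))
    (I : {set 'I_m}) (J : {set 'I_n}) : Prop :=
  [/\ #|I| = b, #|J| = b, \rank (sub_rc M I J) = b
    & frob (M - CUR M I J) <= (b + 1)%:R * frob (M - Z)].

(* Iterations are numbered from 1; [Is j] and [Js j] are the row and column
   indices selected in iteration j, and only the values for 1 <= j <= k matter
   to a run of k iterations. *)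
Section Iteration.
Variables (m n b : nat) (A : 'M[R]_(m, n)) (G : 'M[R]_(b, m)).
Variables (Is : nat -> {set 'I_m}) (Js : nat -> {set 'I_n}).

Definition residual (i : nat) : 'M[R]_(m, n) :=
  A - CUR A (\bigcup_(1 <= j < i) Is j) (\bigcup_(1 <= j < i) Js j).

Definition sketch (i : nat) : 'M[R]_(b, n) := G *m residual i.

Definition sketch_approx (i : nat) : 'M[R]_(m, n) :=
  residual i *m mp_inv (sketch i) *m sketch i.

Definition IterativeCUR_run (k : nat) : Prop :=
  forall i, (1 <= i <= k)%N ->
    osinsky_selection b (residual i) (sketch_approx i) (Is i) (Js i).

Lemma residual1 : residual 1 = A.
Proof.
rewrite /residual !big_geq // /CUR [X in _ - X](_ : _ = 0) ?subr0 //.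
apply/matrixP => i j; rewrite !mxE big1 // => l _.
by have := enum_valP l; rewrite inE.
Qed.

End Iteration.
End Defs.

(* Main.v *)
Require Import Defs.
From mathcomp Require Import all_boot all_order all_algebra.
From mathcomp Require Import reals.

Import Order.TTheory GRing.Theory Num.Theory.
Local Open Scope ring_scope.

(** When the core [A(I,J)] is square and nonsingular, [CUR A I J] is the only
    matrix that agrees with [A] on the rows [I] and has its columns in the span
    of the columns [J] of [A].  The residual [S = A - CUR A I J] vanishes on the
    rows [I] and the columns [J]; so a nonsingular core [S(I',J')] has indices
    disjoint from [I] and [J], the core [A(I :|: I', J :|: J')] is again
    nonsingular, and by the uniqueness just stated
    [A - CUR A (I :|: I') (J :|: J') = S - CUR S I' J'].
    Hence the selection inequality bounds each residual by the previous one,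
    and the product of these bounds is the claim. *)

Section CrossApproximation.
Set Implicit Arguments.
Unset Strict Implicit.
Variable R : realType.

(** * Frobenius norm and pseudoinverses of full-rank matrices *)

Lemma frob_eq0 (m n : nat) (M : 'M[R]_(m, n)) : frob M = 0 -> M = 0.
Proof.
have rge0 i : 0 <= \sum_(j < n) M i j ^+ 2.
  by apply: sumr_ge0 => j _; apply: sqr_ge0.
move/eqP; rewrite /frob sqrtr_eq0 => sle0.
have s0 : \sum_(i < m) \sum_(j < n) M i j ^+ 2 = 0.
  by apply/eqP; rewrite eq_le sle0 sumr_ge0.
apply/matrixP => i j; rewrite mxE; apply/eqP; rewrite -sqrf_eq0; apply/eqP.
have ri := psumr_eq0P (fun i _ => rge0 i) s0 (i := i) isT.
by apply: (psumr_eq0P _ ri) => // l _; apply: sqr_ge0.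
Qed.

Lemma frob0 (m n : nat) : frob (0 : 'M[R]_(m, n)) = 0.
Proof.
rewrite /frob big1 ?sqrtr0 // => i _; rewrite big1 // => j _.
by rewrite mxE expr0n.
Qed.

Lemma mp_inv_row_full (p q : nat) (K : 'M[R]_(p, q)) :
  row_full K -> mp_inv K *m K = 1%:M.
Proof.
move=> Kfull; case/and4P: (mp_invP K) => /eqP e _ _ _.
by apply: (row_full_inj Kfull); rewrite mulmxA e mulmx1.
Qed.

Lemma mp_inv_row_free (p q : nat) (K : 'M[R]_(p, q)) :
  row_free K -> K *m mp_inv K = 1%:M.
Proof.
move=> Kfree; case/and4P: (mp_invP K) => /eqP e _ _ _.
by apply: (row_free_inj Kfree); rewrite e mul1mx.
Qed.

(** * Submatrices and coefficient matrices supported on an index set *)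

Definition row_supp (n p : nat) (J : {set 'I_n}) (Z : 'M[R]_(n, p)) : Prop :=
  forall j l, j \notin J -> Z j l = 0.

(** [sub_c 1%:M J] pads [W] with zero rows outside [J]. Coefficients for the columns [J] thus become
    a matrix with rows indexed by ['I_n], so that different sets [J] can be compared. *)
Lemma sub_c_mul (m n p : nat) (M : 'M[R]_(m, n)) (J : {set 'I_n})
    (W : 'M[R]_(#|J|, p)) : sub_c M J *m W = M *m (sub_c 1%:M J *m W).
Proof. by rewrite mulmxA /sub_c mulmx_colsub mulmx1. Qed.

Lemma sub_r_mul (m n p : nat) (M : 'M[R]_(m, n)) (N : 'M[R]_(n, p))
    (I : {set 'I_m}) : sub_r (M *m N) I = sub_r M I *m N.
Proof. by rewrite /sub_r mul_rowsub_mx. Qed.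

Lemma sub_c_mulr (m n p : nat) (M : 'M[R]_(m, n)) (N : 'M[R]_(n, p))
    (J : {set 'I_p}) : sub_c (M *m N) J = M *m sub_c N J.
Proof. by rewrite /sub_c mulmx_colsub. Qed.

Lemma sub_r_sub_c (m n : nat) (M : 'M[R]_(m, n)) (I : {set 'I_m})
    (J : {set 'I_n}) : sub_r (sub_c M J) I = sub_rc M I J.
Proof. by apply/matrixP => i j; rewrite !mxE. Qed.

Lemma sub_c_sub_r (m n : nat) (M : 'M[R]_(m, n)) (I : {set 'I_m})
    (J : {set 'I_n}) : sub_c (sub_r M I) J = sub_rc M I J.
Proof. by apply/matrixP => i j; rewrite !mxE. Qed.

Lemma row_supp_inj (n p : nat) (J : {set 'I_n}) (W : 'M[R]_(#|J|, p)) :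
  row_supp J (sub_c 1%:M J *m W).
Proof.
move=> j l jJ; rewrite mxE big1 // => i _; rewrite !mxE.
case: eqP => [ji|_]; last by rewrite mul0r.
by move: jJ; rewrite ji enum_valP.
Qed.

Lemma sub_r_inj (n p : nat) (J : {set 'I_n}) (W : 'M[R]_(#|J|, p)) :
  sub_r (sub_c 1%:M J *m W) J = W.
Proof.
rewrite sub_r_mul sub_r_sub_c (_ : sub_rc _ _ _ = 1%:M) ?mul1mx //.
by apply/matrixP => i j; rewrite !mxE (inj_eq enum_val_inj).
Qed.

Lemma mulmx_row_supp (m n p : nat) (M : 'M[R]_(m, n)) (J : {set 'I_n})
    (Z : 'M[R]_(n, p)) : row_supp J Z -> M *m Z = sub_c M J *m sub_r Z J.
Proof.
move=> Zs; apply/matrixP => i l; rewrite !mxE.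
transitivity (\sum_(j in J) M i j * Z j l).
  rewrite [RHS]big_mkcond; apply: eq_bigr => j _.
  by case: ifPn => // jJ; rewrite Zs // mulr0.
by rewrite big_enum_val; apply: eq_bigr => j _; rewrite !mxE.
Qed.

Lemma sub_rE (m n : nat) (M N : 'M[R]_(m, n)) (I : {set 'I_m}) :
  sub_r M I = sub_r N I <-> (forall i l, i \in I -> M i l = N i l).
Proof.
split=> [/matrixP e i l iI|e].
  by have := e (enum_rank_in iI i) l; rewrite !mxE enum_rankK_in.
by apply/matrixP => i l; rewrite !mxE e // enum_valP.
Qed.

(** Vectors of full length relate cores with different index sets without handling their
    enumerations. *)
Lemma row_full_sub_rcP (m n : nat) (M : 'M[R]_(m, n)) (I : {set 'I_m})
    (J : {set 'I_n}) :
  row_full (sub_rc M I J) <->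
  (forall y : 'cV[R]_n, row_supp J y ->
     (forall i, i \in I -> (M *m y) i 0 = 0) -> y = 0).
Proof.
split=> [Kfull y ys My|inj].
  have r0 : sub_r y J = 0.
    apply: (row_full_inj Kfull); rewrite mulmx0 -sub_r_sub_c -sub_r_mul.
    rewrite -mulmx_row_supp //; apply/matrixP => i l.
    by rewrite ord1 mxE My ?mxE ?enum_valP.
  apply/matrixP => j l; rewrite mxE.
  have [jJ|/ys//] := boolP (j \in J).
  move/matrixP: r0 => /(_ (enum_rank_in jJ j) l).
  by rewrite !mxE enum_rankK_in.
(* A row [v] of the left kernel of the transposed core, transposed and padded with zeros, is a
   vector to which [inj] applies. *)
rewrite /row_full -mxrank_tr -/(row_free _) -kermx_eq0.
apply/eqP/row_matrixP => i; rewrite row0; set v := row i _.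
have Kv : sub_rc M I J *m v^T = 0.
  apply: trmx_inj; rewrite trmx_mul trmxK trmx0.
  by apply/sub_kermxP; apply: row_sub.
have y0 : sub_c 1%:M J *m v^T = 0.
  apply: inj; first exact: row_supp_inj.
  move=> i' iI; rewrite -sub_c_mul.
  move: Kv; rewrite -sub_r_sub_c -sub_r_mul => /matrixP.
  by move/(_ (enum_rank_in iI i') 0); rewrite !mxE enum_rankK_in.
apply: trmx_inj; rewrite -[LHS]sub_r_inj y0.
by apply/matrixP => a c; rewrite !mxE.
Qed.

(** * Interpolation, uniqueness and rank of cross approximations *)

Lemma CUR_row (m n : nat) (M : 'M[R]_(m, n)) (I : {set 'I_m}) (J : {set 'I_n}) :
  row_free (sub_rc M I J) -> sub_r (CUR M I J) I = sub_r M I.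
Proof.
by move=> Kf; rewrite /CUR !sub_r_mul sub_r_sub_c mp_inv_row_free // mul1mx.
Qed.

Lemma CUR_col (m n : nat) (M : 'M[R]_(m, n)) (I : {set 'I_m}) (J : {set 'I_n}) :
  row_full (sub_rc M I J) -> sub_c (CUR M I J) J = sub_c M J.
Proof.
move=> Kf.
by rewrite /CUR sub_c_mulr sub_c_sub_r -mulmxA mp_inv_row_full // mulmx1.
Qed.

(** Only the rows of [Z] in [J] enter [M *m Z]. Agreement on the rows [I] writes [sub_r M I] as the
    core times these rows, and the pseudoinverse cancels the core. *)
Lemma CUR_unique (m n : nat) (M : 'M[R]_(m, n)) (I : {set 'I_m})
    (J : {set 'I_n}) (Z : 'M[R]_n) :
  row_full (sub_rc M I J) -> row_supp J Z ->
  sub_r (M *m Z) I = sub_r M I -> CUR M I J = M *m Z.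
Proof.
move=> Kf Zs e; rewrite /CUR -e (mulmx_row_supp M Zs).
by rewrite sub_r_mul sub_r_sub_c -mulmxA (mulmxA (mp_inv _)) mp_inv_row_full
  // mul1mx.
Qed.

Lemma CUR_factor (m n : nat) (M : 'M[R]_(m, n)) (I : {set 'I_m})
    (J : {set 'I_n}) : exists2 Z, row_supp J Z & CUR M I J = M *m Z.
Proof.
exists (sub_c 1%:M J *m (mp_inv (sub_rc M I J) *m sub_r M I)).
  exact: row_supp_inj.
by rewrite -sub_c_mul /CUR mulmxA.
Qed.

(** The factor [sub_r M I] bounds the rank from above; from below, [CUR M I J] agrees with [M] on
    the rows [I] and so contains the core. *)
Lemma rank_CUR (m n : nat) (M : 'M[R]_(m, n)) (I : {set 'I_m})
    (J : {set 'I_n}) : row_free (sub_rc M I J) -> \rank (CUR M I J) = #|I|.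
Proof.
move=> Kf; apply/eqP; rewrite eqn_leq; apply/andP; split.
  by rewrite (leq_trans (mxrankM_maxr _ _)) ?rank_leq_row.
move/eqP: (Kf) => {1}<-.
have -> : sub_rc M I J = sub_r 1%:M I *m CUR M I J *m sub_c 1%:M J.
  by rewrite -sub_r_mul -sub_c_mulr mul1mx mulmx1 CUR_row // sub_c_sub_r.
by rewrite (leq_trans (mxrankM_maxl _ _)) // mxrankM_maxr.
Qed.

(** * Appending indices selected on the residual *)

Section Update.
Variables (m n : nat) (A : 'M[R]_(m, n)).
Variables (I I' : {set 'I_m}) (J J' : {set 'I_n}).
Let S := A - CUR A I J.
Hypothesis Kfree : row_free (sub_rc A I J).
Hypothesis Kfull : row_full (sub_rc A I J).
Hypothesis Lfree : row_free (sub_rc S I' J').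
Hypothesis Lfull : row_full (sub_rc S I' J').

Lemma residual_row0 i l : i \in I -> S i l = 0.
Proof.
move=> iI; move/sub_rE: (CUR_row Kfree) => /(_ i l iI) e.
by rewrite /S !mxE -e !mxE subrr.
Qed.

Lemma residual_col0 i j : j \in J -> S i j = 0.
Proof.
move=> jJ; move/matrixP: (CUR_col Kfull) => /(_ i (enum_rank_in jJ j)).
by rewrite !mxE enum_rankK_in // => e; rewrite -e subrr.
Qed.

Lemma update_disjoint_rows : [disjoint I & I'].
Proof.
apply/pred0P => i /=; apply/negbTE/negP => /andP[iI iI'].
(* A shared index would give the core of [S] a zero row. *)
have : delta_mx 0 (enum_rank_in iI' i) *m sub_rc S I' J' = 0 :> 'rV_ _.
  apply/matrixP => a c; rewrite -rowE [LHS]mxE [LHS]mxE enum_rankK_in //.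
  by rewrite residual_row0 // mxE.
move/eqP; rewrite mulmx_free_eq0 // => /eqP/matrixP/(_ 0 (enum_rank_in iI' i)).
by rewrite !mxE !eqxx => /eqP; rewrite oner_eq0.
Qed.

Lemma update_disjoint_cols : [disjoint J & J'].
Proof.
apply/pred0P => j /=; apply/negbTE/negP => /andP[jJ jJ'].
(* The unit vector at a shared index is supported on [J'] and killed by [S]. *)
have d0 : delta_mx j 0 = 0 :> 'cV[R]_n.
  move/row_full_sub_rcP: Lfull; apply=> [l c lJ|i _].
    by rewrite mxE; case: eqP lJ => // ->; rewrite jJ'.
  by rewrite -colE mxE residual_col0.
by move/matrixP/(_ j 0): d0; rewrite !mxE !eqxx => /eqP; rewrite oner_eq0.
Qed.

(** Block elimination on a kernel vector [y]: the core of [S] kills its entries outside [J], then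
    the core of [A] kills those in [J]. *)
Lemma update_row_full : row_full (sub_rc A (I :|: I') (J :|: J')).
Proof.
apply/row_full_sub_rcP => y ys Ay0.
(* [CUR A I J *m y] depends only on the rows [I] of [A *m y], which vanish. *)
have Sy : S *m y = A *m y.
  rewrite /S mulmxBl /CUR -!mulmxA -sub_r_mul.
  rewrite (_ : sub_r (A *m y) I = 0) ?mulmx0 ?subr0 //.
  apply/matrixP => i l; rewrite ord1 mxE [RHS]mxE Ay0 // inE.
  by rewrite enum_valP.
(* Clearing the entries in [J] preserves [S *m y], since [S] has zero columns there. *)
pose y' : 'cV[R]_n := \col_j (if j \in J then 0 else y j 0).
have Sy' : S *m y' = S *m y.
  apply/matrixP => i l; rewrite ord1 !mxE; apply: eq_bigr => j _.
  rewrite [y' _ _]mxE.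
  by case: ifP => // jJ; rewrite residual_col0 // !mul0r.
have y'0 : y' = 0.
  move/row_full_sub_rcP: Lfull; apply=> [j l jJ'|i iI].
    by rewrite mxE; case: ifPn => // jJ; rewrite ys // inE negb_or jJ.
  by rewrite Sy' Sy Ay0 // inE iI orbT.
move/row_full_sub_rcP: Kfull; apply=> [j l jJ|i iI]; last first.
  by rewrite Ay0 // inE iI.
by move/matrixP/(_ j 0): y'0; rewrite !mxE (negbTE jJ) ord1.
Qed.

Lemma update_residual :
  A - CUR A (I :|: I') (J :|: J') = S - CUR S I' J'.
Proof.
have [Z Zs eZ] := CUR_factor A I J.
have [Z' Z's eZ'] := CUR_factor S I' J'.
(* As [S] is [A] times [1 - Z], the sum of both approximations is [A] times coefficients supported
   on [J :|: J']; [CUR_unique] then needs only its rows. *)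
have e : CUR A I J + CUR S I' J' = A *m (Z + (Z' - Z *m Z')).
  by rewrite eZ' /S eZ mulmxBl !mulmxDr mulmxN mulmxA.
suff -> : CUR A (I :|: I') (J :|: J') = CUR A I J + CUR S I' J'.
  by rewrite /S opprD addrA.
rewrite e; apply: CUR_unique; first exact: update_row_full.
  move=> j l; rewrite inE negb_or => /andP[jJ jJ'].
  rewrite !mxE Zs // Z's // big1 ?subrr ?addr0 // => c _.
  by rewrite Zs // mul0r.
rewrite -e; apply/sub_rE => // i l; rewrite inE.
have SE : S i l = A i l - CUR A I J i l by rewrite !mxE.
(* On the rows [I] the second term vanishes with [S]; on the remaining rows of [I'] it equals [S]
   and restores [A]. *)
have [iI _|niI /= iI'] := boolP (i \in I).
  have S0 := residual_row0 l iI.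
  rewrite mxE eZ' [X in _ + X]mxE big1 ?addr0 => [|c _].
    by apply/esym/eqP; rewrite -subr_eq0 -SE S0.
  by rewrite residual_row0 // mul0r.
by rewrite mxE; move/sub_rE: (CUR_row Lfree) => -> //; rewrite SE addrC subrK.
Qed.

End Update.
End CrossApproximation.

(** * Induction on the number of iterations *)

Theorem theorem4p3 (R : realType) (m n b k : nat)
    (A : 'M[R]_(m, n)) (G : 'M[R]_(b, m))
    (Is : nat -> {set 'I_m}) (Js : nat -> {set 'I_n}) :
  IterativeCUR_run A G Is Js k ->
  let S := residual A Is Js in
  let X := sketch A G Is Js in
  let A_cur := CUR A (\bigcup_(1 <= j < k.+1) Is j)
                     (\bigcup_(1 <= j < k.+1) Js j) in
  \rank A_cur = (b * k)%N /\
  frob (A - A_cur) <=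
    (1 + b)%:R ^+ k * frob A *
    \prod_(1 <= i < k.+1)
      (frob (S i - S i *m mp_inv (X i) *m X i) / frob (S i)).
Proof.
move=> run S X A_cur.
(* The induction also carries the index counts and the nonsingularity of the core, which the update
   needs. *)
suff [cI _ Kfree _ bound] : let I := \bigcup_(1 <= j < k.+1) Is j in
    let J := \bigcup_(1 <= j < k.+1) Js j in
    [/\ #|I| = (b * k)%N, #|J| = (b * k)%N, row_free (sub_rc A I J),
        row_full (sub_rc A I J)
      & frob (S k.+1) <= (1 + b)%:R ^+ k * frob A * \prod_(1 <= i < k.+1)
          (frob (S i - S i *m mp_inv (X i) *m X i) / frob (S i))].
  by split; first by rewrite rank_CUR.
rewrite {}/A_cur; elim: k run => [|k IH] run;
  set I := \bigcup_(_ <= _ < _) Is _; set J := \bigcup_(_ <= _ < _) Js _.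
  have cI : #|I| = 0%N by rewrite /I big_geq // cards0.
  have cJ : #|J| = 0%N by rewrite /J big_geq // cards0.
  rewrite muln0; split=> //.
  - by rewrite /row_free eqn_leq rank_leq_row {1}cI.
  - by rewrite /row_full eqn_leq rank_leq_col {1}cJ.
  - by rewrite /S residual1 [\prod_(_ <= _ < _) _]big_geq // expr0 mul1r mulr1.
have /IH : IterativeCUR_run A G Is Js k.
  by move=> i /andP[i1 ik]; apply: run; rewrite i1 leqW.
set I0 := \bigcup_(1 <= j < k.+1) Is j.
set J0 := \bigcup_(1 <= j < k.+1) Js j => -[cI cJ Kfree Kfull bound].
have [cI' cJ' rL err] := run k.+1 (leqnn _).
have Lfree : row_free (sub_rc (A - CUR A I0 J0) (Is k.+1) (Js k.+1)).
  by apply/eqP; apply: etrans rL (esym cI').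
have Lfull : row_full (sub_rc (A - CUR A I0 J0) (Is k.+1) (Js k.+1)).
  by apply/eqP; apply: etrans rL (esym cJ').
have eI : I = I0 :|: Is k.+1 by rewrite /I big_nat_recr.
have eJ : J = J0 :|: Js k.+1 by rewrite /J big_nat_recr.
have cIk : #|I| = (b * k.+1)%N.
  rewrite eI cardsU disjoint_setI0 ?cards0 ?subn0 ?cI ?cI' ?mulnS 1?addnC //.
  exact: update_disjoint_rows Kfree Lfree.
have cJk : #|J| = (b * k.+1)%N.
  rewrite eJ cardsU disjoint_setI0 ?cards0 ?subn0 ?cJ ?cJ' ?mulnS 1?addnC //.
  exact: update_disjoint_cols Kfull Lfull.
have full : row_full (sub_rc A I J).
  by rewrite eI eJ; apply: update_row_full Kfull Lfull.
(* The core is square, so full column rank gives full row rank. *)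
split=> //; first by rewrite /row_free (eqP full) cJk -{1}cIk.
have eS : S k.+2 = S k.+1 - CUR (S k.+1) (Is k.+1) (Js k.+1).
  rewrite /S /residual -/I -/J eI eJ.
  exact: update_residual Kfree Kfull Lfree Lfull.
rewrite [\prod_(1 <= i < k.+2) _]big_nat_recr //=.
(* If the residual is already zero, the last quotient is zero by the convention for division by
   zero, so the new residual must vanish exactly. *)
have [S0|Sn0] := eqVneq (frob (S k.+1)) 0.
  rewrite S0 invr0 !mulr0 eS (frob_eq0 S0) sub0r.
  have [Z _ ->] := CUR_factor (0 : 'M[R]_(m, n)) (Is k.+1) (Js k.+1).
  by rewrite mul0mx oppr0 frob0.
set T := frob (S k.+1 - _).
(* Inserting the norm of the old residual as factor and divisor leaves a place for the induction
   bound. *)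
have {}err : frob (S k.+2) <=
    (1 + b)%:R * (frob (S k.+1) * (T / frob (S k.+1))).
  by rewrite [frob (S k.+1) * _]mulrC divfK // eS addnC.
have r0 : 0 <= T / frob (S k.+1) by rewrite divr_ge0 // sqrtr_ge0.
apply: le_trans err _; rewrite exprS -!mulrA ler_wpM2l ?ler0n //.
by have := ler_wpM2r r0 bound; rewrite -!mulrA.
Qed.
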